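(* Let $0<\varepsilon<1/3$ and let $A$ be a real $n\times m$ matrix with a $k$-low stable rank tail, i.e. $k\ge\mathrm{sr}(A-A_k)$ for an integer $k\ge1$. Let $R$ be a $t\times n$ random sign matrix rescaled by $1/\sqrt t$ and set $\tilde A=RA$. If $t=\Omega(k/\varepsilon^4)$, then with high probability $\|A-P_{\tilde A,k}(A)\|_2\le(2+\varepsilon)\|A-A_k\|_2$.
   Context: $\mathrm{sr}(X)=\|X\|_F^2/\|X\|_2^2$ is the stable rank. $A_k$ is the best rank-$k$ approximation of $A$. For matrices $A,C$ with the same number of columns, $P_C(A)=AC^{+}C$ ($C^{+}$ the Moore–Penrose pseudo-inverse) and $P_{C,k}(A)$ is the best rank-$k$ approximation of $P_C(A)$. A random sign matrix has i.i.d. entries uniform on $\{\pm1\}$. $\|\cdot\|_2$ is the spectral norm. *)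

(* Defs.v *)
From HB Require Import structures.
From mathcomp Require Import all_boot all_order all_algebra.
From mathcomp Require Import all_classical all_reals all_analysis.

Set Implicit Arguments.
Unset Strict Implicit.
Unset Printing Implicit Defensive.

Import Order.TTheory GRing.Theory Num.Theory.
Local Open Scope classical_set_scope.
Local Open Scope ring_scope.

(* The library norm on matrices is the entrywise maximum, hence the explicit
   Euclidean, spectral and Frobenius norms below. *)
Definition l2norm (R : realType) (n : nat) (x : 'cV[R]_n) : R :=
  Num.sqrt (\sum_i x i 0 ^+ 2).

Definition spectral_norm (R : realType) (n m : nat) (A : 'M[R]_(n, m)) : R :=
  sup [set l2norm (A *m x) | x in [set x : 'cV[R]_m | l2norm x <= 1]].

Definition frobenius_norm (R : realType) (n m : nat) (A : 'M[R]_(n, m)) : R :=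
  Num.sqrt (\sum_i \sum_j A i j ^+ 2).

(* Equal to 0 for the zero matrix, since x / 0 = 0. *)
Definition stable_rank (R : realType) (n m : nat) (A : 'M[R]_(n, m)) : R :=
  frobenius_norm A ^+ 2 / spectral_norm A ^+ 2.

(* Minimizers for the spectral norm need not be unique; the truncated singular
   value decompositions of A are always among them. *)
Definition best_rank_approx (R : realType) (n m k : nat)
    (A B : 'M[R]_(n, m)) : Prop :=
  (\rank B <= k)%N /\
  forall C : 'M[R]_(n, m), (\rank C <= k)%N ->
    spectral_norm (A - B) <= spectral_norm (A - C).

Definition k_low_stable_rank_tail (R : realType) (n m k : nat)
    (A Ak : 'M[R]_(n, m)) : Prop :=
  best_rank_approx k A Ak /\ stable_rank (A - Ak) <= k%:R.

(* The four Penrose equations; mathcomp's pinvmx satisfies only some of them. *)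
Definition is_mp_inverse (R : realType) (t m : nat)
    (C : 'M[R]_(t, m)) (X : 'M[R]_(m, t)) : Prop :=
  [/\ C *m X *m C = C, X *m C *m X = X,
      (C *m X)^T = C *m X & (X *m C)^T = X *m C].

Definition mp_inverse (R : realType) (t m : nat) (C : 'M[R]_(t, m)) :
    'M[R]_(m, t) :=
  xget 0 [set X | is_mp_inverse C X].

Lemma row_free_gram_unit (R : realType) (r m : nat) (G : 'M[R]_(r, m)) :
  row_free G -> G *m G^T \in unitmx.
Proof.
move=> fG; rewrite -row_free_unit -kermx_eq0; apply/eqP/row_matrixP => i.
rewrite row0; set u := row i _.
have uGG : u *m (G *m G^T) = 0.
  by rewrite /u -row_mul mulmx_ker row0.
have uG : u *m G = 0.
  have : (u *m G) *m (u *m G)^T = 0 by rewrite trmx_mul !mulmxA -[u *m G *m _]mulmxA uGG mul0mx.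
  move=> /matrixP/(_ 0 0); rewrite !mxE => /eqP.
  under eq_bigr do rewrite [(_)^T _ _]mxE -expr2.
  rewrite psumr_eq0 => [/allP h|j _]; last exact: sqr_ge0.
  apply/matrixP => a j; rewrite ord1 [RHS]mxE.
  by have := h j (mem_index_enum _); rewrite sqrf_eq0 => /eqP.
by apply: (row_free_inj fG); rewrite mul0mx.
Qed.

Lemma mp_inverse_factor (R : realType) (t r m : nat)
    (F : 'M[R]_(t, r)) (G : 'M[R]_(r, m)) :
  F^T *m F \in unitmx -> G *m G^T \in unitmx ->
  exists X, is_mp_inverse (F *m G) X.
Proof.
move=> uF uG; pose a := invmx (G *m G^T); pose b := invmx (F^T *m F).
have aT : a^T = a by rewrite /a trmx_inv trmx_mul trmxK.
have bT : b^T = b by rewrite /b trmx_inv trmx_mul trmxK.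
pose X := G^T *m a *m (b *m F^T).
have CX : F *m G *m X = F *m b *m F^T.
  have -> : F *m G *m X = F *m (G *m G^T *m a) *m b *m F^T.
    by rewrite /X !mulmxA.
  by rewrite mulmxV// mulmx1.
have XC : X *m (F *m G) = G^T *m a *m G.
  have -> : X *m (F *m G) = G^T *m a *m (b *m (F^T *m F)) *m G.
    by rewrite /X !mulmxA.
  by rewrite mulVmx// mulmx1.
exists X; split.
- rewrite CX.
  have -> : F *m b *m F^T *m (F *m G) = F *m (b *m (F^T *m F)) *m G.
    by rewrite !mulmxA.
  by rewrite mulVmx// mulmx1.
- rewrite XC.
  have -> : G^T *m a *m G *m X = G^T *m a *m (G *m G^T *m a) *m (b *m F^T).
    by rewrite /X !mulmxA.
  by rewrite mulmxV// mulmx1.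
- by rewrite CX !trmx_mul trmxK bT mulmxA.
- by rewrite XC !trmx_mul trmxK aT mulmxA.
Qed.

Lemma mp_inverseP (R : realType) (t m : nat) (C : 'M[R]_(t, m)) :
  is_mp_inverse C (mp_inverse C).
Proof.
apply: (@xgetPex _ 0 [set X | is_mp_inverse C X]).
rewrite -(mulmx_base C); apply: mp_inverse_factor.
  rewrite -{2}[col_base C]trmxK; apply: row_free_gram_unit.
  by rewrite /row_free mxrank_tr; exact: col_base_full.
exact/row_free_gram_unit/row_base_free.
Qed.

Lemma mp_inverse_uniq (R : realType) (t m : nat) (C : 'M[R]_(t, m))
    (X Y : 'M[R]_(m, t)) : is_mp_inverse C X -> is_mp_inverse C Y -> X = Y.
Proof.
move=> [x1 x2 x3 x4] [y1 y2 y3 y4].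
have CXY : C *m X = C *m Y.
  by rewrite -x3 -{1}y1 -mulmxA trmx_mul x3 y3 !mulmxA x1.
have XCY : X *m C = Y *m C.
  by rewrite -x4 -{1}y1 -mulmxA mulmxA trmx_mul x4 y4 -mulmxA [C *m (X *m C)]mulmxA x1.
by rewrite -x2 -mulmxA CXY mulmxA XCY y2.
Qed.

(* The projection of the rows of A onto the row space of C. *)
Definition rowspace_proj (R : realType) (n m t : nat)
    (C : 'M[R]_(t, m)) (A : 'M[R]_(n, m)) : 'M[R]_(n, m) :=
  A *m mp_inverse C *m C.

Definition mutually_independent (R : realType) (d : measure_display)
    (T : measurableType d) (P : probability T R) (I : finType)
    (X : I -> {RV P >-> R}) : Prop :=
  forall (S : {set I}) (B : I -> set R), (forall i, measurable (B i)) ->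
    P (\bigcap_(i in [set` S]) (X i @^-1` B i)) =
    (\prod_(i in S) P (X i @^-1` B i))%E.

Definition uniform_sign (R : realType) (d : measure_display)
    (T : measurableType d) (P : probability T R) (X : {RV P >-> R}) : Prop :=
  P (X @^-1` [set 1]) = (2^-1)%:E /\ P (X @^-1` [set -1]) = (2^-1)%:E.

Definition random_sign_matrix (R : realType) (d : measure_display)
    (T : measurableType d) (P : probability T R) (t n : nat)
    (X : 'I_t -> 'I_n -> {RV P >-> R}) : Prop :=
  (forall i j, uniform_sign (X i j)) /\
  mutually_independent (fun p : 'I_t * 'I_n => X p.1 p.2).

Definition scaled_sample (R : realType) (d : measure_display)
    (T : measurableType d) (P : probability T R) (t n : nat)
    (X : 'I_t -> 'I_n -> {RV P >-> R}) (w : T) : 'M[R]_(t, n) :=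
  (Num.sqrt t%:R)^-1 *: \matrix_(i, j) X i j w.

(* Main.v *)
Require Import Defs.
From mathcomp Require Import all_boot all_order all_algebra.
From mathcomp Require Import all_classical all_reals all_analysis.
From mathcomp Require Import ring lra.

Set Implicit Arguments.
Unset Strict Implicit.
Unset Printing Implicit Defensive.

Import Order.TTheory GRing.Theory Num.Theory.
Local Open Scope classical_set_scope.
Local Open Scope ring_scope.

(* Write E = A - Ak and sigma = ||E||_2, and let R be the rescaled sign matrix.
   Since ||A P - B|| <= ||A P - Ak P|| <= sigma for the projection P onto the
   row space of R A, it suffices that ||A x|| <= sigma ||x|| whenever R A x = 0,
   and this already holds with probability 1 - exp(-c t) when t >= C k.
   Greedily removing 4096 k nearly maximal right singular directions splits
   E = E1 + E2 with rank E1 <= 4096 k and ||E2|| <= sigma / 45.  The vector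
   y = A x - E2 x lies in the fixed space col(Ak) + col(E1) of dimension at
   most 4097 k, and R y = - R E2 x.  On that space a net argument gives
   ||y|| <= 4 ||R y||, so it remains to see that ||R E2|| <= 8 sigma / 45.
   Iterating the greedy step writes E2 as a sum of blocks of rank 4096 k acting
   on orthogonal subspaces, with squared norms w_g of total at most
   (sigma / 45)^2.  The exponential moment of ||R V||^2 for a single block V of
   orthonormal columns is controlled by a net, and by convexity of exp the same
   bound holds for the w-weighted average over all blocks, however many there
   are.  The sign pattern being uniform, all probabilities are counts. *)

(** * Euclidean, Frobenius and spectral norms *)

Lemma l2norm_ge0 (R : realType) (n : nat) (x : 'cV[R]_n) : 0 <= l2norm x.
Proof. exact: sqrtr_ge0. Qed.

Lemma sqr_l2norm (R : realType) (n : nat) (x : 'cV[R]_n) :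
  l2norm x ^+ 2 = \sum_i x i 0 ^+ 2.
Proof. by rewrite sqr_sqrtr// sumr_ge0// => i _; exact: sqr_ge0. Qed.

Lemma sqr_l2normE (R : realType) (n : nat) (x : 'cV[R]_n) :
  l2norm x ^+ 2 = (x^T *m x) 0 0.
Proof. by rewrite sqr_l2norm mxE; apply: eq_bigr => i _; rewrite mxE expr2. Qed.

Lemma l2norm_eq0 (R : realType) (n : nat) (x : 'cV[R]_n) :
  (l2norm x == 0) = (x == 0).
Proof.
apply/idP/eqP => [|->]; last first.
  rewrite -sqrf_eq0 sqr_l2norm big1// => i _; by rewrite mxE expr0n.
rewrite -sqrf_eq0 sqr_l2norm psumr_eq0 => [/allP h|j _]; last exact: sqr_ge0.
apply/matrixP => i j; rewrite ord1 mxE.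
by have := h i (mem_index_enum _); rewrite sqrf_eq0 => /eqP.
Qed.

Lemma l2norm0 (R : realType) (n : nat) : l2norm (0 : 'cV[R]_n) = 0.
Proof. by apply/eqP; rewrite l2norm_eq0. Qed.

Lemma l2normZ (R : realType) (n : nat) (a : R) (x : 'cV[R]_n) :
  l2norm (a *: x) = `|a| * l2norm x.
Proof.
apply/eqP; rewrite -(@eqrXn2 _ 2)// ?mulr_ge0 ?l2norm_ge0//.
rewrite exprMn real_normK ?num_real// !sqr_l2norm mulr_sumr.
by apply/eqP/eq_bigr => i _; rewrite mxE exprMn.
Qed.

Lemma l2normN (R : realType) (n : nat) (x : 'cV[R]_n) :
  l2norm (- x) = l2norm x.
Proof. by rewrite -scaleN1r l2normZ normrN1 mul1r. Qed.

(** The form [\sum_i (u * x i + v * y i) ^+ 2] is nonnegative, and at [u = b], [v = - c] it equals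
    [b * (a * b - c ^+ 2)]. *)
Lemma cauchy_schwarz (R : realType) (I : finType) (x y : I -> R) :
  (\sum_i x i * y i) ^+ 2 <= (\sum_i x i ^+ 2) * (\sum_i y i ^+ 2).
Proof.
set a := \sum_i x i ^+ 2; set b := \sum_i y i ^+ 2; set c := \sum_i x i * y i.
have b0 : 0 <= b by apply: sumr_ge0 => i _; exact: sqr_ge0.
have a0 : 0 <= a by apply: sumr_ge0 => i _; exact: sqr_ge0.
have key u v : 0 <= u ^+ 2 * a + 2 * (u * v) * c + v ^+ 2 * b.
  suff -> : u ^+ 2 * a + 2 * (u * v) * c + v ^+ 2 * b =
      \sum_i (u * x i + v * y i) ^+ 2.
    by apply: sumr_ge0 => i _; exact: sqr_ge0.
  rewrite !mulr_sumr -!big_split/=; apply: eq_bigr => i _; ring.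
have [b_0|b_n0] := eqVneq b 0; last first.
  have bp : 0 < b by rewrite lt_neqAle eq_sym b_n0.
  rewrite -subr_ge0 -(pmulr_rge0 _ bp).
  suff -> : b * (a * b - c ^+ 2) =
      b ^+ 2 * a + 2 * (b * - c) * c + (- c) ^+ 2 * b by exact: key.
  ring.
have y0 i : y i = 0.
  apply/eqP; rewrite -sqrf_eq0; move: b_0 => /eqP.
  rewrite psumr_eq0 => [/allP h|j _]; last exact: sqr_ge0.
  exact: h (mem_index_enum _).
by rewrite /c big1 ?expr0n ?mulr_ge0// => i _; rewrite y0 mulr0.
Qed.

Lemma l2normD (R : realType) (n : nat) (x y : 'cV[R]_n) :
  l2norm (x + y) <= l2norm x + l2norm y.
Proof.
rewrite -(@ler_pXn2r _ 2)// ?nnegrE ?addr_ge0 ?l2norm_ge0// sqrrD.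
have -> : l2norm (x + y) ^+ 2 =
    l2norm x ^+ 2 + 2 * (\sum_i x i 0 * y i 0) + l2norm y ^+ 2.
  rewrite !sqr_l2norm mulr_sumr -!big_split/=.
  by apply: eq_bigr => i _; rewrite mxE; ring.
rewrite lerD2r lerD2l -[leRHS]mulr_natl ler_pM2l//.
apply: (le_trans (ler_norm _)).
rewrite -(@ler_pXn2r _ 2)// ?nnegrE ?mulr_ge0 ?l2norm_ge0//.
by rewrite real_normK ?num_real// exprMn !sqr_l2norm; exact: cauchy_schwarz.
Qed.

Lemma l2norm_sum (R : realType) (n : nat) (I : finType) (x : I -> 'cV[R]_n) :
  l2norm (\sum_i x i) <= \sum_i l2norm (x i).
Proof.
elim/big_ind2 : _ => [|u a v b ua vb|//]; first by rewrite l2norm0.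
by apply: le_trans (l2normD _ _) _; exact: lerD.
Qed.

Lemma l2norm_proj (R : realType) (n : nat) (P : 'M[R]_n) (x : 'cV[R]_n) :
  P^T = P -> P *m P = P ->
  l2norm x ^+ 2 = l2norm (P *m x) ^+ 2 + l2norm ((1%:M - P) *m x) ^+ 2.
Proof.
move=> PT PP; rewrite !sqr_l2normE !trmx_mul linearB/= trmx1 PT.
rewrite -[x^T *m P *m _]mulmxA [P *m (P *m x)]mulmxA PP.
rewrite -[x^T *m (1%:M - P) *m _]mulmxA [(1%:M - P) *m (_ *m x)]mulmxA.
have -> : (1%:M - P) *m (1%:M - P) = 1%:M - P.
  by rewrite mulmxBr mulmx1 mulmxBl mul1mx PP subrr subr0.
rewrite mulmxBl mulmxBr mul1mx -[RHS]/(_ + _) [X in _ = _ + X]mxE.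
by rewrite [X in _ = _ + (_ + X)]mxE; ring.
Qed.

Lemma l2norm_proj_le (R : realType) (n : nat) (P : 'M[R]_n) (x : 'cV[R]_n) :
  P^T = P -> P *m P = P -> l2norm (P *m x) <= l2norm x.
Proof.
move=> PT PP; rewrite -(@ler_pXn2r _ 2)// ?nnegrE ?l2norm_ge0//.
by rewrite (l2norm_proj x PT PP) lerDl sqr_ge0.
Qed.

Lemma projC_proj (R : realType) (n : nat) (P : 'M[R]_n) :
  P^T = P -> P *m P = P ->
  (1%:M - P)^T = 1%:M - P /\ (1%:M - P) *m (1%:M - P) = 1%:M - P.
Proof.
move=> PT PP; split; first by rewrite linearB/= trmx1 PT.
by rewrite mulmxBr mulmx1 mulmxBl mul1mx PP subrr subr0.
Qed.

Lemma sqr_frobenius_sum (R : realType) (n m : nat) (A : 'M[R]_(n, m)) :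
  frobenius_norm A ^+ 2 = \sum_i \sum_j A i j ^+ 2.
Proof.
rewrite sqr_sqrtr//; apply: sumr_ge0 => i _; apply: sumr_ge0 => j _.
exact: sqr_ge0.
Qed.

Lemma sqr_frobenius (R : realType) (n m : nat) (A : 'M[R]_(n, m)) :
  frobenius_norm A ^+ 2 = \tr (A *m A^T).
Proof.
rewrite sqr_frobenius_sum; apply: eq_bigr => i _; rewrite mxE.
by apply: eq_bigr => j _; rewrite mxE expr2.
Qed.

Lemma l2norm_mul_frobenius (R : realType) (n m : nat) (A : 'M[R]_(n, m))
    (x : 'cV[R]_m) : l2norm (A *m x) <= frobenius_norm A * l2norm x.
Proof.
rewrite -(@ler_pXn2r _ 2)// ?nnegrE ?mulr_ge0 ?l2norm_ge0 ?sqrtr_ge0//.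
rewrite exprMn sqr_frobenius_sum !sqr_l2norm mulr_suml.
apply: ler_sum => i _; rewrite mxE; exact: cauchy_schwarz.
Qed.

Lemma spectral_norm_has_sup (R : realType) (n m : nat) (A : 'M[R]_(n, m)) :
  has_sup [set l2norm (A *m x) | x in [set x : 'cV[R]_m | l2norm x <= 1]].
Proof.
split; first by exists (l2norm (A *m 0)), 0 => //=; rewrite l2norm0 ler01.
exists (frobenius_norm A) => _ [x /= x1 <-].
apply: le_trans (l2norm_mul_frobenius A x) _.
by rewrite ler_piMr// sqrtr_ge0.
Qed.

Lemma spectral_norm_ge0 (R : realType) (n m : nat) (A : 'M[R]_(n, m)) :
  0 <= spectral_norm A.
Proof.
apply: (sup_upper_bound (spectral_norm_has_sup A)).
by exists 0; rewrite /= ?mulmx0 l2norm0.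
Qed.

Lemma l2norm_mul_le (R : realType) (n m : nat) (A : 'M[R]_(n, m))
    (x : 'cV[R]_m) : l2norm (A *m x) <= spectral_norm A * l2norm x.
Proof.
have [->|x0] := eqVneq x 0; first by rewrite mulmx0 !l2norm0 mulr0.
have xp : 0 < l2norm x by rewrite lt_neqAle l2norm_ge0 eq_sym l2norm_eq0 x0.
rewrite -ler_pdivrMr//.
apply: (sup_upper_bound (spectral_norm_has_sup A)).
exists ((l2norm x)^-1 *: x) => /=.
  by rewrite l2normZ ger0_norm ?invr_ge0 ?l2norm_ge0// mulVf ?gt_eqF.
by rewrite -scalemxAr l2normZ ger0_norm ?invr_ge0 ?l2norm_ge0// mulrC.
Qed.

Lemma spectral_norm_le (R : realType) (n m : nat) (A : 'M[R]_(n, m)) (c : R) :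
  0 <= c -> (forall x, l2norm (A *m x) <= c * l2norm x) -> spectral_norm A <= c.
Proof.
move=> c0 h; apply: ge_sup; first exact: proj1 (spectral_norm_has_sup A).
move=> _ [x /= x1 <-]; apply: le_trans (h x) _.
by rewrite ler_piMr.
Qed.

Lemma spectral_normD (R : realType) (n m : nat) (A B : 'M[R]_(n, m)) :
  spectral_norm (A + B) <= spectral_norm A + spectral_norm B.
Proof.
apply: spectral_norm_le; first by rewrite addr_ge0// spectral_norm_ge0.
move=> x; rewrite mulmxDl mulrDl; apply: le_trans (l2normD _ _) _.
by apply: lerD; exact: l2norm_mul_le.
Qed.

Lemma spectral_norm_gt0 (R : realType) (n m : nat) (A : 'M[R]_(n, m)) :
  A != 0 -> 0 < spectral_norm A.
Proof.
move=> A0; rewrite lt_neqAle spectral_norm_ge0 andbT.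
apply: contra A0 => /eqP A0; apply/eqP/matrixP => i j.
have : l2norm (A *m delta_mx j 0) == 0.
  rewrite eq_le l2norm_ge0 andbT; apply: le_trans (l2norm_mul_le _ _) _.
  by rewrite -A0 mul0r.
by rewrite l2norm_eq0 -colE => /eqP /matrixP /(_ i 0); rewrite !mxE.
Qed.

(** * Greedy low-rank splitting *)

Lemma mulmx_tr_self (R : realType) (n : nat) (x : 'cV[R]_n) :
  x^T *m x = (l2norm x ^+ 2)%:M.
Proof. by rewrite sqr_l2normE; exact: mx11_scalar. Qed.

(* The maximizing direction may be taken in the row space, since projecting
   onto it does not change [E *m x] and can only shorten [x]. *)
Lemma spectral_norm_near_max (R : realType) (n m : nat) (E : 'M[R]_(n, m)) :
  E != 0 -> exists x : 'cV[R]_m, [/\ l2norm x = 1, (x^T <= E)%MS &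
    spectral_norm E ^+ 2 <= 2 * l2norm (E *m x) ^+ 2].
Proof.
move=> E0; have s0 := spectral_norm_gt0 E0.
(* A slack of one quarter suffices, since (3/4)^2 >= 1/2. *)
have e0 : 0 < spectral_norm E / 4 by rewrite divr_gt0.
have [_ [x0 /= x01 <-] h] := sup_adherent e0 (spectral_norm_has_sup E).
rewrite -/(spectral_norm E) in h.
have [p1 p2 p3 p4] := mp_inverseP E.
set P := mp_inverse E *m E in p4.
have PP : P *m P = P by rewrite /P mulmxA p2.
have EP : E *m (P *m x0) = E *m x0 by rewrite /P !mulmxA p1.
have x1n := l2norm_proj_le x0 p4 PP.
set x1 := P *m x0 in EP x1n.
have x1p : 0 < l2norm x1.
  rewrite lt_neqAle l2norm_ge0 andbT eq_sym l2norm_eq0; apply/eqP => x10.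
  move: h; rewrite -EP x10 mulmx0 l2norm0; lra.
have x1le : l2norm x1 <= 1 by exact: le_trans x1n x01.
exists ((l2norm x1)^-1 *: x1); split.
- by rewrite l2normZ ger0_norm ?invr_ge0 ?l2norm_ge0// mulVf ?gt_eqF.
- rewrite linearZ/= scalemx_sub// /x1 trmx_mul p4 /P mulmxA.
  exact: submxMl.
- rewrite -scalemxAr l2normZ ger0_norm ?invr_ge0 ?l2norm_ge0// EP.
  have : l2norm (E *m x0) <= (l2norm x1)^-1 * l2norm (E *m x0).
    by rewrite ler_peMl ?l2norm_ge0// invf_ge1.
  set y := _ * l2norm _ => hy.
  have := l2norm_ge0 (E *m x0).
  nra.
Qed.

(** Each round removes a direction [x] nearly attaining the norm of the remainder. The squared
    Frobenius norm drops by at least half the squared spectral norm, which never grows, so [d]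
    rounds give the factor [d]. As [x] lies in the row space, the rank drops too. *)
Lemma greedy_projection (R : realType) (n m d : nat) (E : 'M[R]_(n, m)) :
  exists Q : 'M[R]_(m, d), [/\ Q *m Q^T *m Q = Q,
    d%:R * spectral_norm (E *m (1%:M - Q *m Q^T)) ^+ 2 <=
      2 * (frobenius_norm E ^+ 2 -
           frobenius_norm (E *m (1%:M - Q *m Q^T)) ^+ 2) &
    (\rank (E *m (1%:M - Q *m Q^T)) <= \rank E - d)%N].
Proof.
elim: d => [|d [Q [QQ Es Er]]].
  by exists 0; rewrite !mul0mx subr0 mulmx1 subrr mulr0 mul0r subn0.
rewrite -[d.+1]add1n; set E2 := E *m _ in Es Er.
have [E20|E20] := eqVneq E2 0.
  (* Zero columns pad [Q] once nothing remains, so [Q] is only a partial isometry. *)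
  exists (row_mx 0 Q).
  rewrite tr_row_mx mul_row_col mul0mx add0r -/E2 E20 mxrank0; split => //.
    by rewrite mul_mx_row mulmx0 QQ.
  move: Es; rewrite E20.
  suff -> : spectral_norm (0 : 'M[R]_(n, m)) = 0 by rewrite expr0n !mulr0.
  apply/eqP; rewrite eq_le spectral_norm_ge0 andbT spectral_norm_le//.
  by move=> x; rewrite mul0mx l2norm0 mul0r.
have [x [x1 xE xs]] := spectral_norm_near_max E20.
have xx : x^T *m x = 1%:M by rewrite mulmx_tr_self x1 expr1n.
(* [E2] kills the columns of [Q], so its row space is orthogonal to them. *)
have xQ : x^T *m Q = 0.
  have /submxP [u ->] := xE.
  by rewrite /E2 -!mulmxA mulmxBl mul1mx QQ subrr !mulmx0.
have Qx : Q^T *m x = 0 by rewrite -[x]trmxK -trmx_mul xQ trmx0.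
exists (row_mx x Q).
rewrite tr_row_mx mul_row_col.
have E3E : E *m (1%:M - (x *m x^T + Q *m Q^T)) = E2 *m (1%:M - x *m x^T).
  rewrite /E2 -mulmxA; congr (_ *m _).
  rewrite mulmxBr mulmx1 mulmxBl mul1mx.
  have -> : Q *m Q^T *m (x *m x^T) = 0.
    by rewrite -mulmxA [Q^T *m _]mulmxA Qx mul0mx mulmx0.
  by rewrite subr0 opprD addrCA addrC.
have PT : (x *m x^T)^T = x *m x^T by rewrite trmx_mul trmxK.
have PP : x *m x^T *m (x *m x^T) = x *m x^T.
  by rewrite -mulmxA [x^T *m _]mulmxA xx mul1mx.
have [PcT PcP] := projC_proj PT PP.
rewrite E3E; split.
- rewrite mul_mx_row !mulmxDl QQ -!mulmxA xx xQ Qx mulmx1 !mulmx0 addr0 add0r.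
  by [].
- clear E3E; clearbody E2.
  have -> : frobenius_norm (E2 *m (1%:M - x *m x^T)) ^+ 2 =
      frobenius_norm E2 ^+ 2 - l2norm (E2 *m x) ^+ 2.
    rewrite !sqr_frobenius trmx_mul PcT mulmxA -(mulmxA E2) PcP.
    rewrite mulmxBr mulmx1 mulmxBl linearB/=; congr (_ - _).
    by rewrite mulmxA -mulmxA -trmx_mul mxtrace_mulC trace_mx11 sqr_l2normE.
  have : spectral_norm (E2 *m (1%:M - x *m x^T)) <= spectral_norm E2.
    apply: spectral_norm_le; first exact: spectral_norm_ge0.
    move=> y; rewrite -mulmxA; apply: le_trans (l2norm_mul_le _ _) _.
    by apply: ler_wpM2l (l2norm_proj_le _ PcT PcP); exact: spectral_norm_ge0.
  rewrite -(@ler_pXn2r _ 2)// ?nnegrE ?spectral_norm_ge0// => h.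
  rewrite natrD.
  move: Es xs (h) (ler_wpM2l (ler0n R d) h).
  move: (spectral_norm (E2 *m _) ^+ 2) (spectral_norm E2 ^+ 2).
  move: (frobenius_norm E ^+ 2) (frobenius_norm E2 ^+ 2).
  move: (l2norm (E2 *m x) ^+ 2) => a b c e f.
  by clear; lra.
(* The new row space lies in that of [E2] but is orthogonal to [x], hence misses it. *)
- have : (\rank (E2 *m (1%:M - x *m x^T)) < \rank E2)%N.
    apply: rank_ltmx; apply/andP; split.
      rewrite mulmxBr mulmx1 addmx_sub// eqmx_opp mulmxA.
      exact: submx_trans (submxMl _ _) xE.
    apply/negP => /(submx_trans xE) /submxP [u xu].
    have : x^T *m x = 0.
      have Px : (1%:M - x *m x^T) *m x = 0.
        by rewrite mulmxBl mul1mx -mulmxA xx mulmx1 subrr.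
      by rewrite xu -mulmxA -mulmxA Px !mulmx0.
    rewrite xx => /matrixP /(_ 0 0); rewrite !mxE/= => /eqP.
    by rewrite oner_eq0.
  move=> h; rewrite add1n subnS -ltnS prednK; first exact: leq_trans h _.
  exact: leq_ltn_trans (leq0n _) (leq_trans h Er).
Qed.

(** After [p] greedy rounds the rank of [M^T] is exhausted, so the column space of [Q] contains that
    of [M]; the coordinates of [M *m b] are [Q^T *m (M *m b)]. *)
Lemma contraction_basis (R : realType) (n p : nat) (M : 'M[R]_(n, p)) :
  exists V : 'M[R]_(n, p), (forall a, l2norm (V *m a) <= l2norm a) /\
    forall b : 'cV_p, exists2 a, M *m b = V *m a & l2norm a = l2norm (M *m b).
Proof.
have [Q [QQ _ Qr]] := greedy_projection p M^T.
have MQ : Q *m Q^T *m M = M.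
  have : M^T *m (1%:M - Q *m Q^T) = 0.
    apply/eqP; rewrite -mxrank_eq0 -leqn0; apply: leq_trans Qr _.
    by rewrite leqn0 subn_eq0 mxrank_tr rank_leq_col.
  move/(congr1 trmx); rewrite trmx_mul trmxK linearB/= trmx1 trmx_mul trmxK.
  by rewrite mulmxBl mul1mx trmx0 => /eqP; rewrite subr_eq0 => /eqP.
exists Q; split => [a|b].
  have PT : (Q^T *m Q)^T = Q^T *m Q by rewrite trmx_mul trmxK.
  have PP : Q^T *m Q *m (Q^T *m Q) = Q^T *m Q.
    by rewrite -mulmxA [Q *m (_ *m _)]mulmxA QQ.
  rewrite -(@ler_pXn2r _ 2)// ?nnegrE ?l2norm_ge0//.
  rewrite (l2norm_proj a PT PP).
  have -> : l2norm (Q^T *m Q *m a) ^+ 2 = l2norm (Q *m a) ^+ 2.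
    rewrite !sqr_l2normE !trmx_mul !trmxK.
    by rewrite -!mulmxA (mulmxA Q Q^T) (mulmxA (Q *m Q^T)) QQ.
  by rewrite lerDl sqr_ge0.
exists (Q^T *m (M *m b)); first by rewrite !mulmxA MQ.
apply/eqP; rewrite -(@eqrXn2 _ 2)// ?l2norm_ge0//; apply/eqP.
by rewrite !sqr_l2normE trmx_mul trmxK -mulmxA (mulmxA Q) (mulmxA _ M) MQ.
Qed.

(** Blocks of [d] greedy directions are peeled off until the rank is exhausted. A block weighs the
    squared spectral norm of the remainder it is taken from. From the second block on this is at
    most [2 / d] times the preceding drop in squared Frobenius norm, and these drops telescope. *)
Lemma ellipsoid_decomposition (R : realType) (n m d : nat) (E : 'M[R]_(n, m)) :
  (0 < d)%N ->
  exists (N : nat) (w : 'I_N -> R) (V : 'I_N -> 'M[R]_(n, d)),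
  [/\ forall g, 0 <= w g,
      forall g a, l2norm (V g *m a) <= l2norm a,
      \sum_g w g <= spectral_norm E ^+ 2 + 2 / d%:R * frobenius_norm E ^+ 2 &
      forall x, exists2 b : 'I_N -> 'cV[R]_d,
        E *m x = \sum_g Num.sqrt (w g) *: (V g *m b g) &
        \sum_g l2norm (b g) ^+ 2 <= l2norm x ^+ 2].
Proof.
move=> d0; have [r] := ubnP (\rank E); elim: r => // r IH in E *.
rewrite ltnS => Er.
have [E0|E0] := eqVneq E 0.
  exists 0, (fun=> 0), (fun=> 0); split=> [//|g a||x].
  - by rewrite mul0mx l2norm0 l2norm_ge0.
  - rewrite big_ord0 addr_ge0 ?sqr_ge0//.
    by rewrite mulr_ge0 ?divr_ge0 ?sqr_ge0.
  - by exists (fun=> 0); rewrite !big_ord0 ?E0 ?mul0mx ?sqr_ge0.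
have [Q [QQ Es ErQ]] := greedy_projection d E.
set P := Q *m Q^T in Es ErQ.
have PT : P^T = P by rewrite /P trmx_mul trmxK.
have PP : P *m P = P by rewrite {2}/P mulmxA QQ.
have [PcT PcP] := projC_proj PT PP.
set E2 := E *m (1%:M - P) in Es ErQ.
have [|N [w [V [w0 Vle wsum dec]]]] := IH E2.
  apply: leq_ltn_trans ErQ _; apply: leq_trans Er.
  by rewrite ltn_subrL d0 lt0n mxrank_eq0.
have [V0 [V0le V0dec]] := contraction_basis (E *m Q).
have s0 := spectral_norm_gt0 E0.
pose w' (g : 'I_N.+1) := if unlift ord0 g is Some h then w h
  else spectral_norm E ^+ 2.
pose V' (g : 'I_N.+1) := if unlift ord0 g is Some h then V h else V0.
exists N.+1, w', V'; split=> [g|g a||x].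
- by rewrite /w'; case: unliftP => [h _|_]; [exact: w0|exact: sqr_ge0].
- by rewrite /V'; case: unliftP => [h _|_]; [exact: Vle|exact: V0le].
- rewrite big_ord_recl {1}/w' unlift_none lerD2l.
  under eq_bigr do rewrite /w' liftK.
  apply: le_trans wsum _; have dp : 0 < d%:R :> R by rewrite ltr0n.
  have dE z : d%:R * (2 / d%:R * z) = 2 * z :> R.
    by rewrite mulrA; congr (_ * _); rewrite mulrC divfK ?gt_eqF.
  rewrite -(ler_pM2l dp) mulrDr !dE; move: Es.
  move: (d%:R * _) (frobenius_norm E ^+ 2) (frobenius_norm E2 ^+ 2) => a b c.
  by clear; lra.
(* The vector [x] splits orthogonally: the later blocks act on [(1%:M - P) *m x], the new one on
   [P *m x]. *)
- have [b Eb bx] := dec ((1%:M - P) *m x).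
  have [a Ea aE] := V0dec (Q^T *m x).
  pose b' (g : 'I_N.+1) := if unlift ord0 g is Some h then b h
    else (spectral_norm E)^-1 *: a.
  exists b'.
    rewrite big_ord_recl {1}/w' {1}/V' {1}/b' unlift_none.
    under eq_bigr do rewrite /w' /V' /b' liftK.
    rewrite -Eb sqrtr_sqr gtr0_norm// -scalemxAr scalerA mulfV ?gt_eqF//.
    rewrite scale1r -Ea /E2 -!mulmxA (mulmxA Q) (mulmxA (1%:M - P)) PcP -/P.
    by rewrite -mulmxDr -mulmxDl addrC subrK mul1mx.
  rewrite big_ord_recl {1}/b' unlift_none.
  under eq_bigr do rewrite /b' liftK.
  rewrite (l2norm_proj x PT PP) lerD//.
  rewrite ler_pXn2r// ?nnegrE ?l2norm_ge0// l2normZ gtr0_norm ?invr_gt0//.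
  rewrite ler_pdivrMl// aE -mulmxA (mulmxA Q); exact: l2norm_mul_le.
Qed.

(** * Exponential moments of sign sums *)

(** For |x| <= 1/2, adding exp z <= 1/(1 - z) at z = x and z = -x gives 2/(1 - x^2) <= 2(1 + 2x^2).
    Otherwise |x| <= 2x^2 bounds both exponentials. *)
Lemma cosh_le_expR_sqr (R : realType) (x : R) :
  expR x + expR (- x) <= 2 * expR (2 * x ^+ 2).
Proof.
have [x1|x1] := lerP (x ^+ 2) (1 / 4).
  have hx : `|x| <= 1 / 2.
    by rewrite -(@ler_pXn2r _ 2)// ?nnegrE// real_normK ?num_real//; lra.
  have bound (z : R) : `|z| <= 1 / 2 -> expR z <= (1 - z)^-1.
    move=> hz; have := expR_ge1Dx (- z).
    have z1 : 0 < 1 - z by have := ler_norm z; lra.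
    by move=> h; rewrite -[z in expR z]opprK expRN lef_pV2 ?posrE ?expR_gt0.
  have h1 := bound _ hx; have h2 := bound (- x); rewrite normrN opprK in h2.
  apply: le_trans (lerD h1 (h2 hx)) _.
  apply: le_trans (_ : 2 * (1 + 2 * x ^+ 2) <= _); last first.
    by rewrite ler_pM2l// expR_ge1Dx.
  have : -(1 / 2) <= x <= 1 / 2 by rewrite -ler_norml.
  move=> /andP[xl xr].
  have p1 : 0 < 1 - x by lra.
  have p2 : 0 < 1 + x by lra.
  have -> : (1 - x)^-1 + (1 + x)^-1 = 2 / (1 - x ^+ 2).
    field; rewrite !gt_eqF//=; nra.
  have p3 : 0 < 1 - x ^+ 2 by lra.
  rewrite ler_pdivrMr//; have := sqr_ge0 x; nra.
have [x0|x0] := lerP 0 x.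
  have h1 : expR x <= expR (2 * x ^+ 2) by rewrite ler_expR; nra.
  have h2 : expR (- x) <= expR (2 * x ^+ 2) by rewrite ler_expR; nra.
  lra.
have h1 : expR x <= expR (2 * x ^+ 2) by rewrite ler_expR; nra.
have h2 : expR (- x) <= expR (2 * x ^+ 2) by rewrite ler_expR; nra.
lra.
Qed.

(** The cosh bound turns the cross terms into [2 * (2 * s * u * y) ^+ 2], absorbed in the
    coefficient of [u ^+ 2]. The sign of [s] is free, so this serves both tails. *)
Lemma expR_sqr_sign_sum (R : realType) (s u y : R) :
  expR (s * (u + y) ^+ 2) + expR (s * (u - y) ^+ 2) <=
  2 * expR (s * (1 + 8 * s * y ^+ 2) * u ^+ 2 + s * y ^+ 2).
Proof.
have -> : s * (u + y) ^+ 2 = s * u ^+ 2 + s * y ^+ 2 + 2 * s * u * y by ring.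
have -> : s * (u - y) ^+ 2 = s * u ^+ 2 + s * y ^+ 2 + - (2 * s * u * y).
  by ring.
have -> : s * (1 + 8 * s * y ^+ 2) * u ^+ 2 + s * y ^+ 2 =
  s * u ^+ 2 + s * y ^+ 2 + 2 * (2 * s * u * y) ^+ 2 by ring.
rewrite !(expRD (s * u ^+ 2 + s * y ^+ 2)) -mulrDr [leRHS]mulrCA.
by rewrite ler_pM2l ?expR_gt0// cosh_le_expR_sqr.
Qed.

(** A Rademacher sum, [true] coding the sign -1. *)
Definition signed_sum (R : realType) (n : nat) (y : 'I_n -> R)
    (xi : {ffun 'I_n -> bool}) : R := \sum_i (-1) ^+ xi i * y i.

Definition ffun_cons (n : nat) (b : bool) (xi : {ffun 'I_n -> bool}) :
    {ffun 'I_n.+1 -> bool} :=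
  [ffun i => if unlift ord0 i is Some j then xi j else b].

Lemma signed_sum_cons (R : realType) (n : nat) (y : 'I_n.+1 -> R) b xi :
  signed_sum y (ffun_cons b xi) =
  (-1) ^+ b * y ord0 + signed_sum (fun i => y (lift ord0 i)) xi.
Proof.
rewrite /signed_sum big_ord_recl ffunE unlift_none; congr (_ + _).
by apply: eq_bigr => i _; rewrite ffunE liftK.
Qed.

Lemma sum_ffun_cons (R : realType) (n : nat)
    (F : {ffun 'I_n.+1 -> bool} -> R) :
  \sum_xi F xi = \sum_xi (F (ffun_cons false xi) + F (ffun_cons true xi)).
Proof.
have bij : bijective (fun p : bool * {ffun 'I_n -> bool} => ffun_cons p.1 p.2).
  exists (fun xi : {ffun 'I_n.+1 -> bool} =>
    (xi ord0, [ffun j => xi (lift ord0 j)])).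
    move=> [b xi] /=; rewrite ffunE unlift_none; congr (_, _).
    by apply/ffunP => j; rewrite !ffunE liftK.
  move=> xi; apply/ffunP => i; rewrite ffunE /=.
  by case: unliftP => [j ->|->]; rewrite ?ffunE.
rewrite (reindex (fun p => ffun_cons p.1 p.2))/=; last exact: onW_bij.
rewrite -(pair_bigA _ (fun b xi => F (ffun_cons b xi)))/= big_bool.
by rewrite -big_split; apply: eq_bigr => xi _; rewrite addrC.
Qed.

(* Averaging out one sign turns [exp (s (u + xi y)^2)] into
   [exp (s' u^2 + s y^2)] with [s' = s (1 + 8 s y^2)], and [s'] satisfies
   [1 / s' >= 1 / s - 8 y^2]; this propagates along the coordinates. *)
Lemma sum_expR_signed_sum (R : realType) (n : nat) (y : 'I_n -> R) (s b : R) :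
  0 <= s -> 8 * s * \sum_i y i ^+ 2 < 1 ->
  \sum_xi expR (s * (b + signed_sum y xi) ^+ 2) <=
  2 ^+ n * expR (s * (b ^+ 2 + \sum_i y i ^+ 2) /
                 (1 - 8 * s * \sum_i y i ^+ 2)).
Proof.
elim: n => [|n IH] in y s b *.
  move=> s0 _; rewrite big_ord0 mulr0 subr0 divr1 addr0 expr0 mul1r.
  rewrite (bigD1 [ffun=> false])//= big1 ?addr0; last first.
    by move=> xi /eqP; case; apply/ffunP => -[].
  by rewrite /signed_sum big_ord0 addr0.
move=> s0; rewrite big_ord_recl; set q := \sum_(i < n) _ => hq.
have q0 : 0 <= q by apply: sumr_ge0 => i _; exact: sqr_ge0.
set z := y ord0 in hq *.
have z0 : 0 <= z ^+ 2 by exact: sqr_ge0.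
set s1 := s * (1 + 8 * s * z ^+ 2).
have sz : 0 <= s * z ^+ 2 by exact: mulr_ge0.
have sq : 0 <= s * q by exact: mulr_ge0.
have s10 : 0 <= s1 by rewrite /s1 mulr_ge0//; lra.
have key : (1 + 8 * s * z ^+ 2) * (1 - 8 * s * (z ^+ 2 + q)) <= 1 - 8 * s1 * q.
  rewrite /s1 -subr_ge0.
  suff -> : 1 - 8 * (s * (1 + 8 * s * z ^+ 2)) * q -
    (1 + 8 * s * z ^+ 2) * (1 - 8 * s * (z ^+ 2 + q)) =
    64 * (s * z ^+ 2) ^+ 2 by rewrite mulr_ge0// sqr_ge0.
  by ring.
have p0 : 0 < 1 - 8 * s * (z ^+ 2 + q) by rewrite subr_gt0.
have p1 : 0 < 1 + 8 * s * z ^+ 2 by lra.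
have hq1 : 8 * s1 * q < 1.
  by rewrite -subr_gt0; apply: lt_le_trans key; exact: mulr_gt0.
rewrite sum_ffun_cons.
apply: (@le_trans _ _ (\sum_xi 2 * expR (s * z ^+ 2) *
    expR (s1 * (b + signed_sum (fun i => y (lift ord0 i)) xi) ^+ 2))).
  apply: ler_sum => xi _; rewrite !signed_sum_cons expr0 mul1r expr1 mulN1r.
  set u := signed_sum _ xi; rewrite -/z.
  have -> : b + (z + u) = b + u + z by ring.
  have -> : b + (- z + u) = b + u - z by ring.
  apply: le_trans (expR_sqr_sign_sum _ _ _) _.
  by rewrite -/s1 -mulrA -expRD addrC.
rewrite -mulr_sumr.
have := IH (fun i => y (lift ord0 i)) s1 b s10 hq1; rewrite -/q => h.
apply: le_trans (ler_wpM2l _ h) _; first by rewrite mulr_ge0 ?expR_ge0.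
rewrite (exprS 2 n) [leLHS]mulrACA ler_pM2l ?mulr_gt0 ?exprn_gt0//.
rewrite -expRD ler_expR.
have p2 : 0 < 1 - 8 * s1 * q by rewrite subr_gt0.
have le1 : s1 / (1 - 8 * s1 * q) <= s / (1 - 8 * s * (z ^+ 2 + q)).
  rewrite ler_pdivrMr// mulrAC ler_pdivlMr// /s1 -[leLHS]mulrA.
  exact: ler_wpM2l.
have le2 : s <= s / (1 - 8 * s * (z ^+ 2 + q)).
  rewrite ler_pdivlMr// ler_piMr//; lra.
have b0 : 0 <= b ^+ 2 + q by rewrite addr_ge0 ?sqr_ge0.
have h1 := ler_wpM2r b0 le1; have h2 := ler_wpM2r z0 le2.
rewrite (mulrAC s1).
have -> : b ^+ 2 + (z ^+ 2 + q) = z ^+ 2 + (b ^+ 2 + q) by rewrite addrCA.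
by rewrite [leRHS]mulrAC [leRHS]mulrDr; exact: lerD.
Qed.

(** Averaging out one sign yields the factor [expR (- (s * z ^+ 2))] and lowers the rate to
    [s1 = s * (1 - 8 * s * z ^+ 2)]; the quadratic correction in the exponent pays for all these
    reductions. *)
Lemma sum_expRN_signed_sum (R : realType) (n : nat) (y : 'I_n -> R) (s b : R) :
  0 <= s -> 8 * s * \sum_i y i ^+ 2 <= 1 ->
  \sum_xi expR (- (s * (b + signed_sum y xi) ^+ 2)) <=
  2 ^+ n * expR (- (s * (1 - 8 * s * \sum_i y i ^+ 2) * \sum_i y i ^+ 2)).
Proof.
elim: n => [|n IH] in y s b *.
  move=> s0 _; rewrite big_ord0 !mulr0 oppr0 expR0 expr0 mul1r.
  rewrite (bigD1 [ffun=> false])//= big1 ?addr0; last first.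
    by move=> xi /eqP; case; apply/ffunP => -[].
  by rewrite expR_le1 oppr_le0 mulr_ge0 ?sqr_ge0.
move=> s0; rewrite big_ord_recl; set q := \sum_(i < n) _ => hq.
have q0 : 0 <= q by apply: sumr_ge0 => i _; exact: sqr_ge0.
set z := y ord0 in hq *.
have z0 : 0 <= z ^+ 2 by exact: sqr_ge0.
set s1 := s * (1 - 8 * s * z ^+ 2).
have sz : 0 <= s * z ^+ 2 by exact: mulr_ge0.
have sq : 0 <= s * q by exact: mulr_ge0.
have s10 : 0 <= s1 by rewrite /s1 mulr_ge0//; lra.
have s1s : s1 <= s.
  by rewrite /s1 mulrBr mulr1 gerBl mulr_ge0// -mulrA mulr_ge0.
have hq1 : 8 * s1 * q <= 1 by have := ler_wpM2r q0 s1s; lra.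
rewrite sum_ffun_cons.
apply: (@le_trans _ _ (\sum_xi 2 * expR (- (s * z ^+ 2)) *
    expR (- (s1 * (b + signed_sum (fun i => y (lift ord0 i)) xi) ^+ 2)))).
  apply: ler_sum => xi _; rewrite !signed_sum_cons expr0 mul1r expr1 mulN1r.
  set u := signed_sum _ xi; rewrite -/z.
  have -> : b + (z + u) = b + u + z by ring.
  have -> : b + (- z + u) = b + u - z by ring.
  rewrite -!mulNr; apply: le_trans (expR_sqr_sign_sum _ _ _) _.
  rewrite -[leRHS]mulrA -expRD ler_pM2l// ler_expR /s1.
  by rewrite le_eqVlt; apply/orP; left; apply/eqP; ring.
rewrite -mulr_sumr.
have := IH (fun i => y (lift ord0 i)) s1 b s10 hq1; rewrite -/q => h.
apply: le_trans (ler_wpM2l _ h) _; first by rewrite mulr_ge0 ?expR_ge0.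
rewrite (exprS 2 n) [leLHS]mulrACA ler_pM2l ?mulr_gt0 ?exprn_gt0//.
rewrite -expRD ler_expR.
rewrite -opprD lerN2.
have h2 : s1 ^+ 2 * q <= s ^+ 2 * q.
  by apply: ler_wpM2r => //; rewrite ler_pXn2r.
have s1E : s1 = s - 8 * (s ^+ 2 * z ^+ 2) by rewrite /s1; ring.
(* As [s1 = s - 8 * (s ^+ 2 * z ^+ 2)], this reduces to [s1 ^+ 2 * q <= s ^+ 2 * q]. *)
have e1 : s - 8 * s ^+ 2 * (z ^+ 2 + q) <= s1 * (1 - 8 * s1 * q).
  have -> : s1 * (1 - 8 * s1 * q) = s1 - 8 * (s1 ^+ 2 * q) by ring.
  have -> : s - 8 * s ^+ 2 * (z ^+ 2 + q) = s1 - 8 * (s ^+ 2 * q).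
    by rewrite s1E; ring.
  by rewrite lerD2l lerN2 ler_pM2l.
have e2 : s - 8 * s ^+ 2 * (z ^+ 2 + q) <= s.
  by rewrite gerBl mulr_ge0 ?addr_ge0// mulr_ge0 ?sqr_ge0.
have -> : s * (1 - 8 * s * (z ^+ 2 + q)) * (z ^+ 2 + q) =
  (s - 8 * s ^+ 2 * (z ^+ 2 + q)) * z ^+ 2 +
  (s - 8 * s ^+ 2 * (z ^+ 2 + q)) * q by ring.
by apply: lerD; exact: ler_wpM2r.
Qed.

(** * Exponential moments of sign matrices *)

Definition sign_mx (R : realType) (t n : nat)
    (S : {ffun 'I_t -> {ffun 'I_n -> bool}}) : 'M[R]_(t, n) :=
  \matrix_(i, j) (-1) ^+ S i j.

Lemma sqr_l2norm_sign_mx (R : realType) (t n : nat)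
    (S : {ffun 'I_t -> {ffun 'I_n -> bool}}) (y : 'cV[R]_n) :
  l2norm (sign_mx R S *m y) ^+ 2 =
  \sum_i signed_sum (fun j => y j 0) (S i) ^+ 2.
Proof.
rewrite sqr_l2norm; apply: eq_bigr => i _; congr (_ ^+ 2).
by rewrite mxE; apply: eq_bigr => j _; rewrite mxE.
Qed.

(** Rows vary independently, so the sum over patterns of a product over rows is a product of
    sums. *)
Lemma sum_expR_sign_mx (R : realType) (t n : nat) (y : 'cV[R]_n) (s : R) :
  \sum_(S : {ffun 'I_t -> {ffun 'I_n -> bool}})
    expR (s * l2norm (sign_mx R S *m y) ^+ 2) =
  (\sum_xi expR (s * signed_sum (fun j => y j 0) xi ^+ 2)) ^+ t.
Proof.
rewrite -[in RHS](card_ord t) -prodr_const.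
rewrite (bigA_distr_bigA (fun (_ : 'I_t) xi =>
  expR (s * signed_sum (fun j => y j 0) xi ^+ 2))).
apply: eq_bigr => S _.
by rewrite sqr_l2norm_sign_mx mulr_sumr expR_sum.
Qed.

(** At rate [s = 1 / 16] one has [8 * s * q <= 1 / 2] for the squared norm [q], so a row adds at
    most (1/16)/(1/2) = 1/8 to the exponent. *)
Lemma sum_expR_sign_mx_le (R : realType) (t n : nat) (y : 'cV[R]_n) :
  l2norm y <= 1 ->
  \sum_(S : {ffun 'I_t -> {ffun 'I_n -> bool}})
    expR (1 / 16 * l2norm (sign_mx R S *m y) ^+ 2) <=
  (2 ^+ n) ^+ t * expR (t%:R / 8).
Proof.
move=> y1; have : l2norm y ^+ 2 <= 1 by rewrite expr_le1// l2norm_ge0.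
have : 0 <= l2norm y ^+ 2 by exact: sqr_ge0.
rewrite sum_expR_sign_mx sqr_l2norm; set q := \sum_i _ => q0 q1.
rewrite expRM_natl -exprMn; apply: lerXn2r; rewrite ?nnegrE.
- by apply: sumr_ge0 => xi _; exact: expR_ge0.
- by rewrite mulr_ge0 ?exprn_ge0 ?expR_ge0.
have := @sum_expR_signed_sum R n (fun j => y j 0) (1 / 16) 0.
rewrite -/q => h; have {h} := h (divr_ge0 ler01 _) _.
under eq_bigr do rewrite add0r.
move=> h; apply: le_trans (h _ _) _ => //; first by lra.
rewrite ler_pM2l ?exprn_gt0// ler_expR expr0n add0r ler_pdivrMr; lra.
Qed.

(** At rate [s = 1 / 32] one has [8 * s * q <= 1 / 4], so a row gains at least (3/128) q, and q >=
    (31/32)^2 leaves 7/320. *)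
Lemma sum_expRN_sign_mx_le (R : realType) (t n : nat) (y : 'cV[R]_n) :
  31 / 32 <= l2norm y <= 1 ->
  \sum_(S : {ffun 'I_t -> {ffun 'I_n -> bool}})
    expR (- (1 / 32) * l2norm (sign_mx R S *m y) ^+ 2) <=
  (2 ^+ n) ^+ t * expR (- (7 / 320 * t%:R)).
Proof.
move=> /andP[y0 y1]; have : l2norm y ^+ 2 <= 1.
  by rewrite expr_le1// l2norm_ge0.
have : (31 / 32) ^+ 2 <= l2norm y ^+ 2.
  by rewrite ler_pXn2r// ?nnegrE ?l2norm_ge0.
rewrite sum_expR_sign_mx sqr_l2norm; set q := \sum_i _ => q0 q1.
rewrite -(mulNr (7 / 320)).
rewrite expRM_natr -exprMn; apply: lerXn2r; rewrite ?nnegrE.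
- by apply: sumr_ge0 => xi _; exact: expR_ge0.
- by rewrite mulr_ge0 ?exprn_ge0 ?expR_ge0.
have := @sum_expRN_signed_sum R n (fun j => y j 0) (1 / 32) 0.
rewrite -/q; under eq_bigr do rewrite add0r -mulNr.
move=> h; apply: le_trans (h _ _) _ => //; first by lra.
rewrite ler_pM2l ?exprn_gt0// ler_expR lerN2.
nra.
Qed.

(** * Nets of the Euclidean ball *)

(* The net consists of the points of the grid [(L sqrt D)^-1 Z^D] of the unit
   ball; rounding each coordinate towards 0 does not leave the ball.  The
   number of [k] with [sum k <= L D] is bounded by weighting [k] with
   [2^(L D - sum k) >= 1]. *)
Lemma ball_net (R : realType) (D L : nat) : (0 < L)%N ->
  exists (J : finType) (v : J -> 'cV[R]_D),
  [/\ #|J|%:R <= 2 ^+ (L * D) * 4 ^+ D :> R, forall j, l2norm (v j) <= 1 &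
      forall a, l2norm a <= 1 -> exists j, l2norm (a - v j) <= L%:R^-1].
Proof.
move=> L0; pose B := (L * D).+1.
pose s : R := L%:R * Num.sqrt D%:R.
pose pt (f : {ffun 'I_D -> bool * 'I_B}) : 'cV[R]_D :=
  \col_i ((-1) ^+ (f i).1 * ((f i).2%:R / s)).
pose good (f : {ffun 'I_D -> bool * 'I_B}) :=
  (\sum_i (f i).2 <= L * D)%N && (l2norm (pt f) <= 1).
exists {f | good f}, (fun j => pt (val j)); split.
- rewrite card_sig -sum1_card natr_sum.
  apply: (@le_trans _ _ (\sum_(f : {ffun 'I_D -> bool * 'I_B})
     2 ^+ (L * D) * \prod_i (2^-1 ^+ (f i).2))).
    rewrite [leRHS](bigID good)/= -[leLHS]addr0 lerD//; last first.
      apply: sumr_ge0 => f _; apply: mulr_ge0; first exact: exprn_ge0.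
      by apply: prodr_ge0 => i _; rewrite exprn_ge0 ?invr_ge0.
    apply: ler_sum => f /andP[hf _].
    have p0 : 0 < 2 ^+ (\sum_i (f i).2) :> R by rewrite exprn_gt0.
    rewrite prodrXr exprVn -(ler_pM2r p0) mulfVK ?gt_eqF// mul1r.
    by rewrite ler_eXn2l ?ltr1n.
  rewrite -mulr_sumr ler_pM2l ?exprn_gt0//.
  (* Per coordinate, two signs times a geometric series of sum at most 2 give 4. *)
  rewrite -(bigA_distr_bigA (fun (_ : 'I_D) (p : bool * 'I_B) =>
    (2^-1 : R) ^+ p.2)) prodr_const card_ord; apply: lerXn2r; rewrite ?nnegrE//.
    by apply: sumr_ge0 => p _; rewrite exprn_ge0 ?invr_ge0.
  rewrite -(pair_bigA _ (fun _ k => (2^-1 : R) ^+ (k : 'I_B)))/= big_bool/=.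
  suff h : \sum_(k < B) (2^-1 : R) ^+ k <= 2 by have := lerD h h; lra.
  suff -> : \sum_(k < B) (2^-1 : R) ^+ k = 2 - 2 * 2^-1 ^+ B.
    by rewrite gerBl mulr_ge0 ?exprn_ge0 ?invr_ge0.
  elim: (B) => [|b IHb]; first by rewrite big_ord0 expr0; lra.
  by rewrite big_ord_recr/= IHb exprS; field.
- by move=> [f /= /andP[]].
move=> a a1.
have s0 : 0 <= s by rewrite mulr_ge0 ?sqrtr_ge0.
(* Multiplied by [s], this bounds the total of the rounded coordinates by [L * D]. *)
have cs : \sum_i `|a i 0| <= Num.sqrt D%:R.
  rewrite -(@ler_pXn2r _ 2)// ?nnegrE ?sqrtr_ge0//; last first.
    by apply: sumr_ge0.
  rewrite sqr_sqrtr//.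
  have := cauchy_schwarz (fun i : 'I_D => `|a i 0|) (fun=> 1).
  under eq_bigr do rewrite mulr1; move=> h; apply: le_trans h _.
  rewrite [X in _ * X](_ : _ = D%:R); last first.
    by under eq_bigr do rewrite expr1n; rewrite sumr_const card_ord.
  under eq_bigr do rewrite real_normK ?num_real//.
  by rewrite -sqr_l2norm ler_piMl// expr_le1 ?l2norm_ge0.
pose k i := Num.truncn (`|a i 0| * s).
have kle i : (k i)%:R <= `|a i 0| * s.
  by rewrite truncn_le mulr_ge0.
have ksum : (\sum_i k i <= L * D)%N.
  rewrite -(ler_nat R) natr_sum.
  apply: le_trans (ler_sum _ (fun i _ => kle i)) _.
  rewrite -mulr_suml; apply: le_trans (ler_wpM2r s0 cs) _.
  by rewrite /s mulrCA -expr2 sqr_sqrtr// natrM.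
have kB i : (k i < B)%N.
  rewrite ltnS; apply: leq_trans ksum.
  by rewrite (bigD1 i)//= leq_addr.
pose f := [ffun i => (a i 0 < 0, Ordinal (kB i))].
(* An index witnesses that [D] is positive; [D = 0] is treated at the end. *)
have sp (i : 'I_D) : 0 < s.
  by rewrite mulr_gt0 ?ltr0n// sqrtr_gt0 ltr0n (leq_ltn_trans _ (ltn_ord i)).
have fle i : (k i)%:R / s <= `|a i 0| by rewrite ler_pdivrMr ?sp.
have fge i : `|a i 0| - s^-1 <= (k i)%:R / s.
  rewrite ler_pdivlMr ?(sp i)// mulrBl mulVf ?gt_eqF ?(sp i)//.
  by rewrite lerBlDr natr1 ltW// truncnS_gt.
have aE i : a i 0 = (-1) ^+ (a i 0 < 0)%R * `|a i 0|.
  by rewrite -realEsign ?num_real.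
have fgood : good f.
  apply/andP; split; first by under eq_bigr do rewrite ffunE /=.
  apply: le_trans a1; rewrite -(@ler_pXn2r _ 2)// ?nnegrE ?l2norm_ge0//.
  rewrite !sqr_l2norm; apply: ler_sum => i _; rewrite mxE ffunE/=.
  rewrite exprMn sqrr_sign mul1r -[leRHS]real_normK ?num_real//.
  by rewrite ler_pXn2r// nnegrE divr_ge0.
exists (exist _ f fgood) => /=.
rewrite -(@ler_pXn2r _ 2)// ?nnegrE ?l2norm_ge0 ?invr_ge0//.
rewrite sqr_l2norm; apply: (@le_trans _ _ (\sum_(i < D) s ^- 2)).
  apply: ler_sum => i _; rewrite !mxE ffunE/= {1}aE -mulrBr exprMn sqrr_sign.
  rewrite mul1r -exprVn ler_pXn2r// ?nnegrE ?invr_ge0 ?subr_ge0//.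
  by rewrite lerBlDr -lerBlDl fge.
rewrite sumr_const card_ord -[leLHS]mulr_natl /s exprMn sqr_sqrtr//.
have [->|D0] := posnP D; first by rewrite mulr0n mul0r exprn_ge0 ?invr_ge0.
by rewrite invfM mulrCA mulfV ?mulr1 ?exprVn// pnatr_eq0 -lt0n.
Qed.

(** * Sign matrices on subspaces *)

(** Markov's inequality for counts. *)
Lemma card_le_sum (R : realType) (T : finType) (B : pred T) (F : T -> R) :
  (forall x, 0 <= F x) -> (forall x, B x -> 1 <= F x) ->
  #|B|%:R <= \sum_x F x.
Proof.
move=> F0 FB; rewrite -sum1_card natr_sum [leRHS](bigID B)/=.
rewrite -[leLHS]addr0 lerD//; last by apply: sumr_ge0.
by apply: ler_sum.
Qed.

(** Jensen's inequality, by averaging the tangent line of exp at the mean [m]. *)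
Lemma expR_convex_sum (R : realType) (I : finType) (p u : I -> R) :
  (forall i, 0 <= p i) -> \sum_i p i = 1 ->
  expR (\sum_i p i * u i) <= \sum_i p i * expR (u i).
Proof.
move=> p0 p1; set m := \sum_i p i * u i.
have -> : expR m = \sum_i p i * (expR m * (1 + (u i - m))).
  under eq_bigr => i _ do rewrite mulrCA.
  rewrite -mulr_sumr; under eq_bigr => i _ do rewrite mulrDr mulr1 mulrBr.
  by rewrite big_split/= p1 sumrB -mulr_suml p1 mul1r subrr addr0 mulr1.
apply: ler_sum => i _; apply: ler_wpM2l => //.
rewrite -[u i in leRHS](subrKC m) expRD ler_pM2l ?expR_gt0//.
exact: expR_ge1Dx.
Qed.

Lemma exp2_le_expR (R : realType) (a : nat) : 2 ^+ a <= expR a%:R :> R.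
Proof.
rewrite -[a%:R]mulr1 expRM_natl; apply: lerXn2r; rewrite ?nnegrE ?expR_ge0//.
by apply: le_trans (expR_ge1Dx 1).
Qed.

(** At the net point of largest image, rounding costs at most half the norm, which is absorbed on
    the left. *)
Lemma net_spectral_norm (R : realType) (t D : nat) (M : 'M[R]_(t, D))
    (J : finType) (v : J -> 'cV[R]_D) :
  (forall a, l2norm a <= 1 -> exists j, l2norm (a - v j) <= 2%:R^-1) ->
  exists j, spectral_norm M <= 2 * l2norm (M *m v j).
Proof.
move=> net; have [|j0 _] := net 0; first by rewrite l2norm0 ler01.
pose j1 := [arg max_(j > j0) l2norm (M *m v j)]%O.
exists j1; have j1P j : l2norm (M *m v j) <= l2norm (M *m v j1).
  by rewrite /j1; case: arg_maxP => // i _; apply.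
suff : spectral_norm M <= l2norm (M *m v j1) + spectral_norm M / 2 by lra.
apply: ge_sup; first exact: proj1 (spectral_norm_has_sup M).
move=> _ [a /= a1 <-]; have [j aj] := net a a1.
rewrite -[a in leLHS](subrKC (v j)) mulmxDr.
apply: le_trans (l2normD _ _) _; apply: lerD => //.
apply: le_trans (l2norm_mul_le _ _) _.
by rewrite ler_wpM2l// spectral_norm_ge0.
Qed.

(** Passing to a 1/2-net multiplies the squared norm by at most 4, turning 1/64 into 1/16. The net
    has at most [2 ^+ (4 * D)] points, which is below exp(t/8). *)
Lemma sum_expR_spectral_sign_mx (R : realType) (t n D : nat)
    (V : 'M[R]_(n, D)) :
  (forall a, l2norm (V *m a) <= l2norm a) -> (32 * D <= t)%N ->
  \sum_(S : {ffun 'I_t -> {ffun 'I_n -> bool}})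
    expR (1 / 64 * spectral_norm (sign_mx R S *m V) ^+ 2) <=
  (2 ^+ n) ^+ t * expR (t%:R / 4).
Proof.
move=> Vle tD; have [J [v [cardJ v1 net]]] := ball_net R D (isT : (0 < 2)%N).
apply: (@le_trans _ _ (\sum_(S : {ffun 'I_t -> {ffun 'I_n -> bool}}) \sum_j
    expR (1 / 16 * l2norm (sign_mx R S *m (V *m v j)) ^+ 2))).
  apply: ler_sum => S _.
  have [j hj] := net_spectral_norm (sign_mx R S *m V) net.
  rewrite (bigD1 j)//= -[leLHS]addr0 lerD//; last first.
    by apply: sumr_ge0 => i _; exact: expR_ge0.
  rewrite ler_expR; move: hj; rewrite -mulmxA => hj.
  have := spectral_norm_ge0 (sign_mx R S *m V).
  have := l2norm_ge0 (sign_mx R S *m (V *m v j)).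
  move: hj; move: (spectral_norm _) (l2norm _) => p q; clear; nra.
rewrite exchange_big/=.
apply: (@le_trans _ _ (\sum_(j : J) (2 ^+ n) ^+ t * expR (t%:R / 8))).
  apply: ler_sum => j _; apply: sum_expR_sign_mx_le.
  exact: le_trans (Vle _) (v1 j).
rewrite sumr_const -[leLHS]mulr_natl mulrCA ler_pM2l ?exprn_gt0//.
have -> : t%:R / 4 = t%:R / 8 + t%:R / 8 :> R by lra.
rewrite expRD ler_pM2r ?expR_gt0//; apply: le_trans cardJ _.
have -> : 2 ^+ (2 * D) * 4 ^+ D = 2 ^+ (4 * D) :> R.
  have -> : 4 = 2 ^+ 2 :> R by rewrite -natrX.
  by rewrite -exprM -exprD -mulnDl.
apply: le_trans (exp2_le_expR R _) _; rewrite ler_expR.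
by rewrite ler_pdivlMr// -natrM ler_nat mulnC mulnA.
Qed.

(** Markov's inequality for three functions: [F1] controls the norm on [U], [F2] the lower bound at
    net points, [F3] the weighted blocks. Since [U] may shrink vectors, the lower bound concerns
    those whose norm it preserves. *)
Lemma sign_mx_failure_card (R : realType) (t n D d N : nat) (U : 'M[R]_(n, D))
    (w : 'I_N -> R) (V : 'I_N -> 'M[R]_(n, d)) :
  (forall a, l2norm (U *m a) <= l2norm a) ->
  (forall g, 0 <= w g) -> (forall g a, l2norm (V g *m a) <= l2norm a) ->
  (10000 * D <= t)%N -> (32 * d <= t)%N ->
  #|[pred S : {ffun 'I_t -> {ffun 'I_n -> bool}} | ~~ `[<
     (forall a, l2norm (U *m a) = l2norm a ->
       Num.sqrt t%:R * l2norm a <= 4 * l2norm (sign_mx R S *m (U *m a))) /\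
     \sum_g w g * spectral_norm (sign_mx R S *m V g) ^+ 2 <=
       64 * t%:R * \sum_g w g >]]|%:R <=
  (2 ^+ n) ^+ t * (3 * expR (- (t%:R / 100))) :> R.
Proof.
move=> Ule w0 Vle tD td.
have [J [v [cardJ v1 net]]] := ball_net R D (isT : (0 < 32)%N).
set W := \sum_g w g.
have W0 : 0 <= W by apply: sumr_ge0.
pose F1 (S : {ffun 'I_t -> {ffun 'I_n -> bool}}) :=
  expR (1 / 64 * spectral_norm (sign_mx R S *m U) ^+ 2 - t%:R).
(* Only these net points can be within 1/32 of a unit vector whose norm [U] keeps; [F2 S < 1] forces
   squared lengths of at least t/4 there. *)
pose F2 (S : {ffun 'I_t -> {ffun 'I_n -> bool}}) :=
  \sum_(j | 31 / 32 <= l2norm (U *m v j))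
    expR (- (1 / 32) * l2norm (sign_mx R S *m (U *m v j)) ^+ 2 + t%:R / 128).
(* A weighted average instead of a union bound keeps the estimate free of [N]. *)
pose F3 (S : {ffun 'I_t -> {ffun 'I_n -> bool}}) := \sum_g w g / W *
  expR (1 / 64 * spectral_norm (sign_mx R S *m V g) ^+ 2 - t%:R).
have F1_ge0 S : 0 <= F1 S by exact: expR_ge0.
have F2_ge0 S : 0 <= F2 S by apply: sumr_ge0 => j _; exact: expR_ge0.
have F3_ge0 S : 0 <= F3 S.
  by apply: sumr_ge0 => g _; rewrite mulr_ge0 ?expR_ge0 ?divr_ge0.
apply: le_trans (card_le_sum (F := fun S => F1 S + F2 S + F3 S) _ _) _.
- by move=> S; rewrite !addr_ge0.
- move=> S /=; apply: contraR; rewrite -ltNge => FS; apply/asboolP.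
  have {}FS1 : F1 S < 1 by move: (F2_ge0 S) (F3_ge0 S) => ? ?; lra.
  have {}FS2 : F2 S < 1 by move: (F1_ge0 S) (F3_ge0 S) => ? ?; lra.
  have {}FS3 : F3 S < 1 by move: (F1_ge0 S) (F2_ge0 S) => ? ?; lra.
  set M := sign_mx R S in FS1 FS2 FS3 *.
  split; last first.
    have [WE|Wn0] := eqVneq W 0.
      rewrite WE mulr0 big1// => g _.
      suff -> : w g = 0 by rewrite mul0r.
      move: WE => /eqP; rewrite psumr_eq0// => /allP h.
      by apply/eqP; exact: h (mem_index_enum _).
    have Wp : 0 < W by rewrite lt_neqAle eq_sym Wn0.
    have p1 : \sum_g w g / W = 1 by rewrite -mulr_suml mulfV.
    have p0 g : 0 <= w g / W by rewrite divr_ge0.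
    have := le_lt_trans (expR_convex_sum (fun g =>
      1 / 64 * spectral_norm (M *m V g) ^+ 2 - t%:R) p0 p1) FS3.
    rewrite -[X in _ < X](expR0 R) ltr_expR.
    under [X in X < 0]eq_bigr do rewrite mulrBr.
    rewrite sumrB -[X in _ - X]mulr_suml p1 mul1r subr_lt0.
    rewrite [X in X < _](_ : _ =
        (\sum_g w g * spectral_norm (M *m V g) ^+ 2) / (64 * W)).
      rewrite ltr_pdivrMr ?mulr_gt0// => /ltW.
      by rewrite mul1r [t%:R * _]mulrCA mulrA.
    rewrite mulr_suml; apply: eq_bigr => g _; field.
    by rewrite Wn0.
  have Ms : spectral_norm (M *m U) <= 8 * Num.sqrt t%:R.
    rewrite -(@ler_pXn2r _ 2)// ?nnegrE ?mulr_ge0 ?sqrtr_ge0//; last first.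
      exact: spectral_norm_ge0.
    rewrite exprMn sqr_sqrtr//.
    move: FS1; rewrite /F1 -[X in _ < X](expR0 R) ltr_expR -/M.
    by move: (_ ^+ 2) => z; lra.
  have Mv j : 31 / 32 <= l2norm (U *m v j) ->
      Num.sqrt t%:R / 2 <= l2norm (M *m (U *m v j)).
    move=> hj.
    rewrite -(@ler_pXn2r _ 2)// ?nnegrE ?divr_ge0 ?sqrtr_ge0 ?l2norm_ge0//.
    rewrite expr_div_n sqr_sqrtr//.
    have : expR (- (1 / 32) * l2norm (M *m (U *m v j)) ^+ 2 + t%:R / 128) < 1.
      apply: le_lt_trans FS2; rewrite /F2 (bigD1 j)//= -[leLHS]addr0 lerD//.
      by apply: sumr_ge0 => i _; exact: expR_ge0.
    rewrite -[X in _ < X](expR0 R) ltr_expR.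
    by move: (l2norm _ ^+ 2) => z; lra.
  (* Rounding to the net costs 8/32 of [Num.sqrt t%:R], leaving 1/2 - 1/4. *)
  have unit a : l2norm a = 1 -> l2norm (U *m a) = 1 ->
      Num.sqrt t%:R <= 4 * l2norm (M *m (U *m a)).
    move=> a1 Ua1; have [|j aj] := net a; first by rewrite a1.
    have UvE : U *m a = U *m v j + U *m (a - v j) by rewrite -mulmxDr subrKC.
    have hj : 31 / 32 <= l2norm (U *m v j).
      have := l2normD (U *m v j) (U *m (a - v j)); rewrite -UvE Ua1.
      by have := Ule (a - v j); lra.
    have : l2norm (M *m (U *m v j)) <=
        l2norm (M *m (U *m a)) + Num.sqrt t%:R / 4.
      have -> : M *m (U *m v j) = M *m (U *m a) + - (M *m U *m (a - v j)).
        by rewrite UvE mulmxDr !mulmxA addrK.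
      apply: le_trans (l2normD _ _) _; rewrite lerD2l l2normN.
      apply: le_trans (l2norm_mul_le _ _) _.
      have -> : Num.sqrt t%:R / 4 = 8 * Num.sqrt t%:R * 32%:R^-1 :> R by field.
      by apply: ler_pM; rewrite ?spectral_norm_ge0 ?l2norm_ge0.
    by have := Mv j hj; lra.
  move=> a Ua; have [a0|an0] := eqVneq a 0.
    by rewrite a0 !mulmx0 !l2norm0 !mulr0.
  have ap : 0 < l2norm a by rewrite lt_neqAle l2norm_ge0 eq_sym l2norm_eq0 an0.
  have := unit ((l2norm a)^-1 *: a).
  rewrite -!scalemxAr !l2normZ gtr0_norm ?invr_gt0// Ua mulVf ?gt_eqF//.
  move=> /(_ erefl erefl).
  by rewrite mulrCA -ler_pdivrMl ?invr_gt0// invrK mulrC.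
rewrite !big_split/= -addrA.
set K := (2 ^+ n) ^+ t; have K0 : 0 < K by rewrite !exprn_gt0.
have t0 : 0 <= t%:R :> R by [].
have F1_le : \sum_S F1 S <= K * expR (- (t%:R / 100)).
  rewrite /F1; under eq_bigr do rewrite expRD.
  rewrite -mulr_suml.
  have tD32 : (32 * D <= t)%N by apply: leq_trans tD; rewrite leq_mul2r orbT.
  have := sum_expR_spectral_sign_mx Ule tD32.
  move=> /(ler_wpM2r (expR_ge0 (- t%:R))) h; apply: le_trans h _.
  by rewrite -[leLHS]mulrA ler_pM2l// -expRD ler_expR; lra.
have F3_le : \sum_S F3 S <= K * expR (- (t%:R / 100)).
  rewrite /F3 exchange_big/=.
  apply: (@le_trans _ _ (\sum_g w g / W * (K * expR (- (t%:R / 100))))).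
    apply: ler_sum => g _; rewrite -mulr_sumr ler_wpM2l ?divr_ge0//.
    under eq_bigr do rewrite expRD.
    rewrite -mulr_suml.
    have := sum_expR_spectral_sign_mx (Vle g) td.
    move=> /(ler_wpM2r (expR_ge0 (- t%:R))) h; apply: le_trans h _.
    by rewrite -[leLHS]mulrA ler_pM2l// -expRD ler_expR; lra.
  rewrite -mulr_suml -mulr_suml -/W ler_piMl ?mulr_ge0 ?expR_ge0 ?(ltW K0)//.
  have [->|W1] := eqVneq W 0; first by rewrite mul0r ler01.
  by rewrite mulfV.
(* The rate is 7/320 - 1/128 = 9/640. The net has at most exp(34 D) points, and 34 D <= 34 t/10000
   still leaves t/100. *)
have F2_le : \sum_S F2 S <= K * expR (- (t%:R / 100)).
  rewrite /F2 exchange_big/=.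
  apply: (@le_trans _ _ (\sum_(j : J) K * expR (- (9 / 640 * t%:R)))).
    rewrite [leRHS](bigID (fun j => 31 / 32 <= l2norm (U *m v j)))/=.
    rewrite -[leLHS]addr0 lerD//; last first.
      by apply: sumr_ge0 => i _; rewrite mulr_ge0 ?expR_ge0 ?ltW.
    apply: ler_sum => j hj.
    under eq_bigr do rewrite expRD.
    rewrite -mulr_suml.
    have hj2 : 31 / 32 <= l2norm (U *m v j) <= 1.
      by rewrite hj (le_trans (Ule _) (v1 j)).
    have := sum_expRN_sign_mx_le t hj2.
    move=> /(ler_wpM2r (expR_ge0 (t%:R / 128))) h; apply: le_trans h _.
    by rewrite -[leLHS]mulrA ler_pM2l// -expRD ler_expR; lra.
  rewrite sumr_const -[leLHS]mulr_natl mulrCA ler_pM2l//.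
  apply: le_trans (ler_wpM2r (expR_ge0 _) cardJ) _.
  have -> : 2 ^+ (32 * D) * 4 ^+ D = 2 ^+ (34 * D) :> R.
    have -> : 4 = 2 ^+ 2 :> R by rewrite -natrX.
    by rewrite -exprM -exprD -mulnDl.
  apply: le_trans (ler_wpM2r (expR_ge0 _) (exp2_le_expR R _)) _.
  rewrite -expRD ler_expR; move: tD; rewrite -(ler_nat R) !natrM; lra.
lra.
Qed.

(** * Sketching *)

(* A best rank-k approximation [B] of [A P], with [P] the projection onto the
   row space of [C], is at least as close to [A P] as [Ak P] is. *)
Lemma rowspace_proj_approx (R : realType) (n m t k : nat)
    (A Ak B : 'M[R]_(n, m)) (C : 'M[R]_(t, m)) :
  (\rank Ak <= k)%N ->
  (forall x, C *m x = 0 ->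
     l2norm (A *m x) <= spectral_norm (A - Ak) * l2norm x) ->
  best_rank_approx k (rowspace_proj C A) B ->
  spectral_norm (A - B) <= 2 * spectral_norm (A - Ak).
Proof.
move=> rAk kerC [_ bestB]; have [p1 p2 p3 p4] := mp_inverseP C.
rewrite /rowspace_proj -mulmxA in bestB.
set P := mp_inverse C *m C in p4 bestB.
have PP : P *m P = P by rewrite /P mulmxA p2.
have [PcT PcP] := projC_proj p4 PP.
have s0 := spectral_norm_ge0 (A - Ak).
have -> : A - B = A *m (1%:M - P) + (A *m P - B).
  by rewrite mulmxBr mulmx1 addrA subrK.
apply: le_trans (spectral_normD _ _) _; rewrite mulr_natl mulr2n lerD//.
  apply: spectral_norm_le => // x; rewrite -mulmxA.
  have Cx : C *m ((1%:M - P) *m x) = 0.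
    by rewrite mulmxA mulmxBr mulmx1 /P mulmxA p1 subrr mul0mx.
  by apply: le_trans (kerC _ Cx) _; rewrite ler_wpM2l// l2norm_proj_le.
apply: le_trans (bestB (Ak *m P) _) _.
  exact: leq_trans (mxrankM_maxl _ _) rAk.
rewrite -mulmxBl; apply: spectral_norm_le => // x; rewrite -mulmxA.
by apply: le_trans (l2norm_mul_le _ _) _; rewrite ler_wpM2l// l2norm_proj_le.
Qed.

(* Split [A - Ak = E Pi + E2] with [rank Pi <= 4096 k] and [E2] so small that
   [M] is harmless on it.  If [M A x = 0] then [y = A x - E2 x] lies in a space
   of dimension at most [4097 k], on which [M] is bounded below, and
   [M y = - M E2 x]. *)
Lemma sketch_kernel_card (R : realType) (n m k t : nat) (A Ak : 'M[R]_(n, m)) :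
  (0 < k)%N -> (\rank Ak <= k)%N ->
  frobenius_norm (A - Ak) ^+ 2 <= k%:R * spectral_norm (A - Ak) ^+ 2 ->
  (10000 * (4097 * k) <= t)%N ->
  #|[pred S : {ffun 'I_t -> {ffun 'I_n -> bool}} | ~~ `[<
     forall x, sign_mx R S *m A *m x = 0 ->
       l2norm (A *m x) <= spectral_norm (A - Ak) * l2norm x >]]|%:R <=
  (2 ^+ n) ^+ t * (3 * expR (- (t%:R / 100))) :> R.
Proof.
move=> k0 rAk; set E := A - Ak; set sg := spectral_norm E => fE tk.
pose d := (4096 * k)%N.
have d0 : (0 < d)%N by rewrite muln_gt0.
have [Q [QQ Es _]] := greedy_projection d E.
set P := Q *m Q^T in Es; set E2 := E *m (1%:M - P) in Es.
have [N [w [V [w0 Vle wsum dec]]]] := ellipsoid_decomposition E2 d0.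
have [U [Ule Udec]] := contraction_basis (row_mx (col_base Ak) (E *m Q)).
have sg0 : 0 <= sg by exact: spectral_norm_ge0.
have kp : 0 < k%:R :> R by rewrite ltr0n.
have dR : d%:R = 4096 * k%:R :> R by rewrite natrM.
have dp : 0 < d%:R :> R by rewrite ltr0n.
(* Multiplied by [d], the Frobenius norms of [E2] cancel and 2 k sg^2 remains, where 2 <=
   4096/45^2. *)
have small : spectral_norm E2 ^+ 2 + 2 / d%:R * frobenius_norm E2 ^+ 2 <=
    (sg / 45) ^+ 2.
  have dE z : d%:R * (2 / d%:R * z) = 2 * z :> R.
    by rewrite mulrA; congr (_ * _); rewrite mulrC divfK ?gt_eqF.
  rewrite -(ler_pM2l dp) mulrDr dE.
  have -> : d%:R * (sg / 45) ^+ 2 = 4096 / 2025 * (k%:R * sg ^+ 2).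
    by rewrite dR; field.
  have : 0 <= k%:R * sg ^+ 2 by rewrite mulr_ge0 ?sqr_ge0.
  move: Es fE; move: (d%:R * _).
  move: (frobenius_norm E ^+ 2) (frobenius_norm E2 ^+ 2).
  by move: (k%:R * _) => a b c e; clear; lra.
have s45 : 0 <= sg / 45 by rewrite divr_ge0.
have sE2 : spectral_norm E2 <= sg / 45.
  rewrite -(@ler_pXn2r _ 2)// ?nnegrE ?spectral_norm_ge0//.
  apply: le_trans small; rewrite lerDl mulr_ge0 ?divr_ge0 ?sqr_ge0//.
have wsmall : \sum_g w g <= (sg / 45) ^+ 2 := le_trans wsum small.
apply: le_trans (sign_mx_failure_card Ule w0 Vle _ _); last 2 first.
- by apply: leq_trans tk; rewrite leq_mul2l /= (mulSn 4096) leq_add2r.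
- by apply: leq_trans tk; rewrite leq_mul// leq_mul2r orbT.
rewrite ler_nat; apply/subset_leq_card/fintype.subsetP => S; rewrite !inE.
apply: contra => /asboolP [lowU upV]; apply/asboolP => x.
set M := sign_mx R S in lowU upV * => MAx.
have tp : (0 < t)%N by apply: leq_trans tk; rewrite !muln_gt0 k0.
have st : 0 < Num.sqrt t%:R :> R by rewrite sqrtr_gt0 ltr0n.
have [b E2x bx] := dec x.
have [a Ua aE] := Udec (col_mx (row_base Ak *m x) (Q^T *m x)).
have yE : row_mx (col_base Ak) (E *m Q) *m
    col_mx (row_base Ak *m x) (Q^T *m x) = A *m x - E2 *m x.
  rewrite mul_row_col mulmxA mulmx_base mulmxA -(mulmxA E) -/P -!mulmxDl.
  rewrite -mulmxBl; congr (_ *m x).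
  have AE : A = Ak + E by rewrite /E addrC subrK.
  by rewrite /E2 mulmxBr mulmx1 opprB [in RHS]AE addrACA subrr addr0.
rewrite yE in Ua aE.
have My : M *m (U *m a) = - (M *m (E2 *m x)).
  by rewrite -Ua mulmxBr (mulmxA M A) MAx sub0r.
(* Cauchy-Schwarz over the blocks pairs [upV] with the bound on the [b g]. *)
have ME2 : l2norm (M *m (E2 *m x)) <= 8 * Num.sqrt t%:R * (sg / 45) * l2norm x.
  rewrite E2x mulmx_sumr; apply: le_trans (l2norm_sum _) _.
  apply: (@le_trans _ _ (\sum_g Num.sqrt (w g) * spectral_norm (M *m V g) *
      l2norm (b g))).
    apply: ler_sum => g _; rewrite -scalemxAr l2normZ ger0_norm ?sqrtr_ge0//.
    by rewrite -mulrA ler_wpM2l ?sqrtr_ge0// mulmxA l2norm_mul_le.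
  apply: le_trans (ler_norm _) _.
  rewrite -(@ler_pXn2r _ 2)// ?nnegrE; last first.
    by rewrite !mulr_ge0 ?sqrtr_ge0 ?l2norm_ge0.
  rewrite real_normK ?num_real// exprMn.
  apply: le_trans (cauchy_schwarz _ _) _.
  apply: ler_pM => //; try by apply: sumr_ge0 => g _; exact: sqr_ge0.
  under eq_bigr => g _ do rewrite exprMn sqr_sqrtr//.
  apply: le_trans upV _.
  have e8 : 8 ^+ 2 = 64 :> R by rewrite -natrX.
  by rewrite exprMn [(8 * _) ^+ 2]exprMn sqr_sqrtr// e8 ler_wpM2l.
have ya : l2norm a <= 32 / 45 * sg * l2norm x.
  have := lowU a (esym (etrans aE (congr1 (@l2norm R n) Ua))).
  rewrite My l2normN => h; rewrite -(ler_pM2l st); apply: le_trans h _.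
  have := ler_wpM2l (ler0n R 4) ME2.
  suff -> : 4 * (8 * Num.sqrt t%:R * (sg / 45) * l2norm x) =
    Num.sqrt t%:R * (32 / 45 * sg * l2norm x) by [].
  by field.
have -> : A *m x = (A *m x - E2 *m x) + E2 *m x by rewrite subrK.
apply: le_trans (l2normD _ _) _; rewrite -aE.
have h2 : l2norm (E2 *m x) <= sg / 45 * l2norm x.
  apply: le_trans (l2norm_mul_le _ _) _.
  by rewrite ler_wpM2r ?l2norm_ge0.
(* The two contributions add up to 32/45 + 1/45 < 1. *)
have : 0 <= sg * l2norm x by rewrite mulr_ge0 ?l2norm_ge0.
lra.
Qed.

(** * From counts of sign patterns to probabilities *)

Definition sign_event (R : realType) (d : measure_display)
    (T : measurableType d) (P : probability T R) (t n : nat)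
    (X : 'I_t -> 'I_n -> {RV P >-> R})
    (S : {ffun 'I_t -> {ffun 'I_n -> bool}}) : set T :=
  \bigcap_(p in [set` [set: 'I_t * 'I_n]%SET])
    (X p.1 p.2 @^-1` [set (-1) ^+ S p.1 p.2]).

Lemma measurable_sign_event (R : realType) (d : measure_display)
    (T : measurableType d) (P : probability T R) (t n : nat)
    (X : 'I_t -> 'I_n -> {RV P >-> R})
    (S : {ffun 'I_t -> {ffun 'I_n -> bool}}) :
  measurable (sign_event X S).
Proof.
apply: fin_bigcap_measurable; first exact: finite_finset.
move=> p _; rewrite -[X in measurable X]setTI.
exact: measurable_funP.
Qed.

Lemma prob_sign_event (R : realType) (d : measure_display)
    (T : measurableType d) (P : probability T R) (t n : nat)
    (X : 'I_t -> 'I_n -> {RV P >-> R})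
    (S : {ffun 'I_t -> {ffun 'I_n -> bool}}) :
  random_sign_matrix X -> P (sign_event X S) = ((2 ^+ n) ^+ t)^-1%:E.
Proof.
move=> [Xu Xi].
rewrite /sign_event (Xi _ (fun p => [set (-1) ^+ S p.1 p.2]))//.
rewrite (eq_bigr (fun=> (2^-1)%:E)); last first.
  move=> p _; have [h1 h2] := Xu p.1 p.2.
  by case: (S p.1 p.2); rewrite ?expr1 ?expr0.
rewrite prodEFin prodr_const cardsT card_prod !card_ord.
by rewrite -exprM mulnC exprVn.
Qed.

Lemma trivIset_sign_event (R : realType) (d : measure_display)
    (T : measurableType d) (P : probability T R) (t n : nat)
    (X : 'I_t -> 'I_n -> {RV P >-> R})
    (D : set {ffun 'I_t -> {ffun 'I_n -> bool}}) :
  trivIset D (sign_event X).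
Proof.
move=> S S' _ _ [w [hS hS']]; apply/ffunP => i; apply/ffunP => j.
have ijT : [set` [set: 'I_t * 'I_n]%SET] (i, j) by rewrite /= finset.in_setT.
have h1 := hS _ ijT; have h2 := hS' _ ijT.
move: h1 h2 => /= ->.
by case: (S i j); case: (S' i j) => //; rewrite expr0 expr1 => h; exfalso; lra.
Qed.

Lemma prob_sign_pattern (R : realType) (d : measure_display)
    (T : measurableType d) (P : probability T R) (t n : nat)
    (X : 'I_t -> 'I_n -> {RV P >-> R})
    (B : pred {ffun 'I_t -> {ffun 'I_n -> bool}}) :
  random_sign_matrix X ->
  P (\bigcup_(S in [set S | B S]) sign_event X S) =
  (1 - #|[predC B]|%:R / (2 ^+ n) ^+ t)%:E.
Proof.
move=> Xsign; rewrite measure_fin_bigcup; last 3 first.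
- exact: finite_finset.
- exact: trivIset_sign_event.
- by move=> S _; exact: measurable_sign_event.
rewrite (fsbigE (enum B)) ?enum_uniq//; last 2 first.
- by move=> S /=; rewrite mem_enum.
- by move=> S /= BS; rewrite mem_enum => /negP[].
rewrite big_enum_cond/=.
under eq_bigr do rewrite (prob_sign_event _ Xsign).
rewrite sumEFin sumr_const; congr (_%:E).
set K := _ ^+ t; have K0 : K != 0 by rewrite !expf_neq0.
rewrite -[LHS]mulr_natl -[X in X - _](mulfV K0) -mulrBl; congr (_ * _).
have cE := cardC B.
rewrite card_ffun card_ffun !card_ord card_bool in cE.
apply/eqP; rewrite eq_sym subr_eq -natrD; apply/eqP.
rewrite /K -!natrX -cE; congr (_%:R); congr addn.
apply: eq_card => S; apply/idP/andP => [BS|[]//].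
by split=> //; exact: mem_set.
Qed.

Theorem theorem3p6 (R : realType) :
  exists C c : R, 0 < C /\ 0 < c /\
  forall (n m k t : nat) (eps : R) (A Ak : 'M[R]_(n, m))
    (d : measure_display) (T : measurableType d) (P : probability T R)
    (X : 'I_t -> 'I_n -> {RV P >-> R}),
    0 < eps -> eps < 1 / 3 -> (1 <= k)%N ->
    k_low_stable_rank_tail k A Ak ->
    random_sign_matrix X ->
    C * (k%:R / eps ^+ 4) <= t%:R ->
    exists G : set T,
      measurable G /\
      ((1 - expR (- (c * eps ^+ 2 * t%:R)))%:E <= P G)%E /\
      forall w, G w ->
        forall B : 'M[R]_(n, m),
          best_rank_approx k (rowspace_proj (scaled_sample X w *m A) A) B ->
          spectral_norm (A - B) <= (2 + eps) * spectral_norm (A - Ak).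
Proof.
(* [C] comes from the condition [10000 * (4097 * k) <= t], as k/eps^4 >= k. [c] is half of the rate
   1/100; the other half absorbs the factor 3, since 1 + t/200 >= 3 for t >= 400. *)
exists (10000 * 4097), (1 / 200).
have C0 : 0 < 10000 * 4097 :> R by apply: mulr_gt0; rewrite ltr0n.
split; first exact: C0.
split; first by rewrite divr_gt0.
move=> n m k t eps A Ak d T P X eps0 eps3 k1 [[rAk _] sr] Xsign tC.
have eps1 : eps <= 1 by lra.
have tk : (10000 * (4097 * k) <= t)%N.
  rewrite -(ler_nat R) !natrM mulrA; apply: le_trans tC.
  rewrite (ler_pM2l C0) ler_peMr// invf_ge1 ?exprn_gt0//.
  by rewrite exprn_ile1// ltW.
have t400 : 400 <= t%:R :> R.
  rewrite (ler_nat R 400); apply: leq_trans tk.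
  by apply: (@leq_mul 400 1 10000) => //; rewrite muln_gt0.
clear tC C0.
have fE : frobenius_norm (A - Ak) ^+ 2 <= k%:R * spectral_norm (A - Ak) ^+ 2.
  (* Clearing the denominator of the stable rank requires a nonzero tail. *)
  have [E0|E0] := eqVneq (A - Ak) 0.
    rewrite E0 sqr_frobenius mul0mx mxtrace0.
    by rewrite mulr_ge0 ?sqr_ge0.
  by rewrite -ler_pdivrMr// exprn_gt0// spectral_norm_gt0.
pose good (S : {ffun 'I_t -> {ffun 'I_n -> bool}}) := `[<
  forall x, sign_mx R S *m A *m x = 0 ->
    l2norm (A *m x) <= spectral_norm (A - Ak) * l2norm x >].
(* A finite union of sign events is measurable whatever the condition on [S], and on it every entry
   is a genuine sign. *)
exists (\bigcup_(S in [set S | good S]) sign_event X S).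
split; first by apply: fin_bigcup_measurable => [|S _];
  [exact: finite_finset|exact: measurable_sign_event].
split.
  rewrite prob_sign_pattern// lee_fin lerD2l lerN2.
  rewrite ler_pdivrMr ?exprn_gt0//.
  apply: le_trans (sketch_kernel_card k1 rAk fE tk) _.
  rewrite mulrC ler_pM2r ?exprn_gt0//.
  apply: (@le_trans _ _ (expR (t%:R / 200) * expR (- (t%:R / 100)))).
    rewrite ler_pM2r ?expR_gt0//; apply: le_trans (expR_ge1Dx _); lra.
  rewrite -expRD ler_expR.
  have : eps ^+ 2 * t%:R <= t%:R by rewrite ler_piMl// exprn_ile1// ltW.
  by rewrite -(mulrA (1 / 200)); lra.
move=> w [S /= /asboolP goodS SW] B bestB.
have XE : scaled_sample X w = (Num.sqrt t%:R)^-1 *: sign_mx R S.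
  congr (_ *: _); apply/matrixP => i j; rewrite !mxE.
  have ijT : [set` [set: 'I_t * 'I_n]%SET] (i, j) by rewrite /= finset.in_setT.
  exact: (SW _ ijT).
(* A nonzero scaling leaves the kernel of the sketch unchanged. *)
have st : (Num.sqrt t%:R)^-1 != 0 :> R.
  by rewrite invr_eq0 gt_eqF// sqrtr_gt0; lra.
apply: (@le_trans _ _ (2 * spectral_norm (A - Ak))); last first.
  by rewrite ler_wpM2r ?spectral_norm_ge0//; lra.
apply: rowspace_proj_approx rAk _ bestB => x; rewrite XE -!scalemxAl.
by move/eqP; rewrite scaler_eq0 (negbTE st) => /eqP; exact: goodS.
Qed.
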